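(* Let $\Omega\subset\mathbb{R}^d$ be a bounded open set, let $f$ be a signed measure of finite mass on $\Omega$, and let $\psi:[0,+\infty)\to[0,+\infty]$ be convex and superlinear, i.e. $$\lim_{s\to+\infty}\frac{\psi(s)}{s}=+\infty .$$ For $a\in L^1(\Omega)$ with $a\ge 0$ a.e. set $$\mathcal{E}(a)=\inf_{u\in C^1_0(\Omega)}\left\{\int_\Omega\Big(\frac12 a(x)|\nabla u|^2-\frac12\psi(a(x))\Big)\,dx-\int_\Omega u\,df\right\}.$$ Assume that $f$ is such that $\mathcal{E}(a)>-\infty$ for at least one coefficient $a\in L^1(\Omega)$, $a\ge0$. Then the functional $\mathcal{E}$ admits a maximizer $a_{opt}\in L^1(\Omega)$: $a_{opt}\ge0$ a.e. and $\mathcal{E}(a_{opt})\ge\mathcal{E}(a)$ for every $a\in L^1(\Omega)$ with $a\ge 0$ a.e.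
   Context: $C^1_0(\Omega)$ denotes the usual space of real-valued $C^1$ functions on $\Omega$ with zero boundary values. If $\int_\Omega\psi(a)\,dx=+\infty$, then $\mathcal{E}(a)=-\infty$.
   Formalization: ψ is additionally assumed lower semicontinuous on [0,+∞); without this the claim fails, e.g. for f=0, Ω nonempty, ψ(0)=1 and ψ(s)=s² for s>0, where the supremum 0 of E is not attained. *)

(* Defs.v *)
From HB Require Import structures.
From mathcomp Require Import all_boot all_order all_algebra.
From mathcomp Require Import lra.
From mathcomp Require Import all_classical all_reals all_analysis.

Set Implicit Arguments.
Unset Strict Implicit.
Unset Printing Implicit Defensive.

Import Order.TTheory GRing.Theory Num.Theory.
Import numFieldNormedType.Exports.

Local Open Scope classical_set_scope.
Local Open Scope ring_scope.

Section borel_rV.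
Context {R : realType} {d : nat}.

HB.instance Definition _ := @isMeasurable.Build
  (sigma_display (@open 'rV[R]_d)) 'rV[R]_d <<s @open 'rV[R]_d >>
  (@sigma_algebra0 _ setT _) (@sigma_algebraC _ _)
  (@sigma_algebra_bigcup _ setT _).

Lemma open_measurable_rV (U : set 'rV[R]_d) : open U -> measurable U.
Proof. by move=> oU; exact: sub_sigma_algebra. Qed.

End borel_rV.

Section measurable_rV.
Context {R : realType}.

Lemma measurable_coord_rV (d : nat) (j : 'I_d) :
  measurable_fun [set: 'rV[R]_d] (fun v : 'rV[R]_d => v 0 j : measurableTypeR R).
Proof.
apply: (@measurability _ _ 'rV[R]_d (measurableTypeR R) setT _
  (@measurable_realfun.RGenOpens.G R)).
  exact: measurable_realfun.RGenOpens.measurableE.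
move=> _ [_ [x [y ->]] <-]; rewrite setTI; apply: open_measurable_rV.
apply: open_comp; last exact: interval_open.
by move=> v _; exact: coord_continuous.
Qed.

Lemma measurable_fun_rV d0 (T : measurableType d0) (d : nat)
    (f : T -> 'rV[R]_d) :
  (forall j, measurable_fun setT (fun t => f t 0 j : measurableTypeR R)) ->
  measurable_fun setT f.
Proof.
move=> mf; apply: (@measurability _ _ _ _ setT f (@open 'rV[R]_d)) => //.
move=> _ [U oU <-]; rewrite setTI.
pose B (qn : 'rV[rat]_d * nat) : set 'rV[R]_d :=
  [set v | forall j, v 0 j \in
     `](ratr (qn.1 0 j) - qn.2.+1%:R^-1)%R, (ratr (qn.1 0 j) + qn.2.+1%:R^-1)%R[].
pose C qn : set T := if `[< B qn `<=` U >] then f @^-1` (B qn) else set0.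
have mB qn : measurable (f @^-1` B qn).
  rewrite (_ : _ @^-1` _ = \bigcap_(j in [set: 'I_d])
      (fun t => f t 0 j : measurableTypeR R) @^-1`
      `](ratr (qn.1 0 j) - qn.2.+1%:R^-1)%R, (ratr (qn.1 0 j) + qn.2.+1%:R^-1)%R[%classic).
    apply: fin_bigcap_measurable => [|j _]; first exact: finite_finset.
      by rewrite -[X in measurable X]setTI; apply: mf => //; exact: measurable_itv.
  by apply/seteqP; split => t /= h j; [move=> _|]; apply: h.
rewrite (_ : f @^-1` U = \bigcup_qn C qn).
  apply: countable_bigcupT_measurable; first exact: countableP.
  by move=> qn; rewrite /C; case: ifPn => _.
apply/seteqP; split => [t Uft|t [qn _]]; last first.
  by rewrite /C; case: ifPn => // /asboolP BU /BU.
have [e /= e0 eU] : nbhs_ball (f t) U by apply/nbhs_ballP; exact: open_nbhs_nbhs.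
have [n] := ltr_add_invr e0; rewrite add0r => ne.
pose r : R := n.+1.*2%:R^-1.
have r0 : 0 < r by rewrite invr_gt0.
have q_ j : exists q : rat, ratr q \in `](f t 0 j - r), (f t 0 j + r)[.
  by apply: rat_in_itvoo; rewrite ltrD2l gt0_cp.
pose q : 'rV[rat]_d := \row_j projT1 (cid (q_ j)).
have qE j : ratr (q 0 j) \in `](f t 0 j - r), (f t 0 j + r)[.
  by rewrite mxE; case: cid.
have n2 : (n.+1.*2.-1.+1 = n.+1.*2)%N by [].
exists (q, n.+1.*2.-1) => //; rewrite /C; case: ifPn => [_|/asboolP].
  move=> j /=; have := qE j; rewrite n2 -/r !in_itv/= => /andP[h1 h2].
  by rewrite ltrBlDr h2 -ltrBlDr h1.
case; move=> v /= Bv; apply: eU; split=> // i j; rewrite (ord1 i).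
have := Bv j; have := qE j; rewrite n2 -/r !in_itv/= => /andP[h1 h2] /andP[h3 h4].
apply: lt_trans ne; rewrite (_ : n.+1%:R^-1 = r + r); last first.
  by rewrite /r -muln2 natrM invfM -splitr.
rewrite /= ltr_distl; apply/andP; split.
  by lra.
by lra.
Qed.

End measurable_rV.

Section lebesgue_rV.
Context {R : realType}.

Definition row_cons (d : nat) (p : measurableTypeR R * 'rV[R]_d) : 'rV[R]_d.+1 :=
  row_mx (p.1 : R)%:M p.2.

Definition row_uncons (d : nat) (v : 'rV[R]_d.+1) : measurableTypeR R * 'rV[R]_d :=
  (v 0 0, \row_j v 0 (lift ord0 j)).

Lemma row_consE d p j :
  @row_cons d p 0 j = if unlift ord0 j is Some k then p.2 0 k else p.1.
Proof.
case: unliftP => [k|] ->; rewrite /row_cons.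
  rewrite (_ : lift ord0 k = rshift 1 k); last exact/val_inj.
  exact: row_mxEr.
transitivity (row_mx (p.1 : R)%:M p.2 0 (lshift d 0)).
  by congr (row_mx _ _ 0 _); exact/val_inj.
by rewrite row_mxEl mxE eqxx.
Qed.

Lemma row_consK d : cancel (@row_cons d) (@row_uncons d).
Proof.
move=> [x v]; rewrite /row_uncons; congr pair; first by rewrite row_consE unlift_none.
by apply/rowP => j; rewrite mxE row_consE liftK.
Qed.

Lemma row_unconsK d : cancel (@row_uncons d) (@row_cons d).
Proof.
move=> v; apply/rowP => j; rewrite row_consE.
by case: unliftP => [k|] ->; rewrite ?mxE.
Qed.

Lemma measurable_row_cons d : measurable_fun setT (@row_cons d).
Proof.
apply: measurable_fun_rV => j; case: (unliftP ord0 j) => [k|] ->.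
  rewrite (_ : (fun _ => _) = (fun v : 'rV[R]_d => v 0 k : measurableTypeR R) \o snd).
    by apply: measurableT_comp => //; exact: measurable_coord_rV.
  by apply/funext => p; rewrite row_consE liftK.
rewrite (_ : (fun _ => _) = fst); first exact: measurable_fst.
by apply/funext => p; rewrite row_consE unlift_none.
Qed.

Lemma measurable_row_uncons d : measurable_fun setT (@row_uncons d).
Proof.
apply: measurable_fun_pair; first exact: measurable_coord_rV.
apply: measurable_fun_rV => j.
under eq_fun do rewrite mxE.
exact: measurable_coord_rV.
Qed.

Section step.
Context {d : nat} (m : {sigma_finite_measure set 'rV[R]_d -> \bar R}).

Definition lebesgue_step : set 'rV[R]_d.+1 -> \bar R :=
  pushforward (lebesgue_measure \x m)%E (@row_cons d).

HB.instance Definition _ := Measure.copy lebesgue_step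
  (measure_function_pushforward__canonical__measure_function_Measure
    (lebesgue_measure \x m)%E (@measurable_row_cons d)).

Let lebesgue_step_sigma_finite : sigma_finite setT lebesgue_step.
Proof.
have /sigma_finiteP[F [TF ndF Foo]] :=
  sigma_finiteT (@lebesgue_measure R : {sigma_finite_measure set _ -> \bar R}).
have /sigma_finiteP[G [TG ndG Goo]] := sigma_finiteT m.
exists (fun n => @row_uncons d @^-1` (F n `*` G n)).
  rewrite -preimage_bigcup; apply/seteqP; split=> // v _ /=.
  have [i _ Fi] : (\bigcup_i F i) (row_uncons v).1 by rewrite -TF.
  have [j _ Gj] : (\bigcup_i G i) (row_uncons v).2 by rewrite -TG.
  exists (maxn i j) => //; split.
    by move: Fi; exact/subsetPset/ndF/leq_maxl.
  by move: Gj; exact/subsetPset/ndG/leq_maxr.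
move=> n; have [mF Fn] := Foo n; have [mG Gn] := Goo n; split.
  rewrite -[X in measurable X]setTI.
  by apply: measurable_row_uncons => //; exact: measurableX.
rewrite /lebesgue_step /pushforward -comp_preimage.
rewrite (_ : _ \o _ = id); last by apply/funext => p /=; rewrite row_consK.
by rewrite [ltLHS]product_measure1E// lte_mul_pinfty// ge0_fin_numE.
Qed.

HB.instance Definition _ := @Measure_isSigmaFinite.Build _ _ _ lebesgue_step
  lebesgue_step_sigma_finite.

End step.

Fixpoint lebesgue_rV (d : nat) : {sigma_finite_measure set 'rV[R]_d -> \bar R} :=
  if d is d'.+1 then lebesgue_step (lebesgue_rV d') else \d_(0 : 'rV[R]_0).

End lebesgue_rV.

(* Integral of g over D against a signed measure of finite mass: the positive
   and negative parts are those of a Hahn decomposition, and do not depend on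
   its choice. *)
Section charge_integral.
Context {disp : measure_display} {T : measurableType disp} {R : realType}.
Variable nu : {charge set T -> \bar R}.
Local Open Scope ereal_scope.

Let hahnP := cid (Hahn_decomposition nu).
Let hahnN := cid (projT2 hahnP).

Definition charge_integral (D : set T) (g : T -> R) : \bar R :=
  \int[jordan_pos (projT2 hahnN)]_(x in D) (g x)%:E -
  \int[jordan_neg (projT2 hahnN)]_(x in D) (g x)%:E.

End charge_integral.

Section functional.
Context {R : realType} {d : nat}.
Implicit Types (Omega : set 'rV[R]_d) (psi : R -> \bar R).
Implicit Types (u a : 'rV[R]_d -> R).

Definition grad u (x : 'rV[R]_d) : 'rV[R]_d :=
  \row_i 'D_(delta_mx 0 i) u x.

Definition sqr_eucl_norm (v : 'rV[R]_d) : R := \sum_i v 0 i ^+ 2.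

(* For Omega open; only the values of u on Omega matter, and no bound is
   imposed on the gradient. *)
Definition C10 Omega : set ('rV[R]_d -> R) :=
  [set u | [/\ forall x, Omega x -> differentiable u x,
     forall x, Omega x -> {for x, continuous (grad u)} &
     forall x, closure Omega x -> ~ Omega x ->
       u y @[y --> within Omega (nbhs x)] --> (0 : R)]].

(* psi is only meaningful on [0, +oo[: its values at negative reals are
   replaced by +oo. *)
Definition ext_psi psi (s : R) : \bar R := if 0 <= s then psi s else +oo%E.

Definition convex_nneg psi := forall s t l : R,
  0 <= s -> 0 <= t -> 0 <= l <= 1 ->
  (psi (l * s + (1 - l) * t)%R <= l%:E * psi s + (1 - l)%:E * psi t)%E.

Definition superlinear psi := (psi s * (s^-1)%:E)%E @[s --> +oo] --> +oo%E.

Definition L1_nneg Omega : set ('rV[R]_d -> R) :=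
  [set a | (lebesgue_rV d).-integrable Omega (EFin \o a) /\
    {ae lebesgue_rV d, forall x, Omega x -> 0 <= a x}].

Local Open Scope ereal_scope.

Definition energy Omega psi (f : {charge set 'rV[R]_d -> \bar R}) a u : \bar R :=
  \int[lebesgue_rV d]_(x in Omega)
    ((2^-1 * a x * sqr_eucl_norm (grad u x))%:E - 2^-1%:E * ext_psi psi (a x))
  - charge_integral f Omega u.

(* If the integral of psi(a) is +oo, the competitor u = 0 already gives the
   value -oo. *)
Definition calE Omega psi (f : {charge set 'rV[R]_d -> \bar R}) a : \bar R :=
  ereal_inf [set energy Omega psi f a u | u in C10 Omega].

End functional.

(* Main.v *)
Require Import Defs.
From mathcomp Require Import all_boot all_order all_algebra.
From mathcomp Require Import lra.
From mathcomp Require Import all_classical all_reals all_analysis.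
From mathcomp Require Import measurable_realfun.

(** The maximizer comes from the direct method, with convex combinations in the
    role of weak compactness.

    Fix a test function [u] whose gradient is bounded. By superlinearity there is a
    constant [C] such that [psi s / 2 - s |grad u|^2 / 2 + C >= 0] for all
    [s >= 0], so that, up to constants depending on [u], minus the energy is the
    integral of a nonnegative integrand which is convex and lower semicontinuous
    in the value of the coefficient. Near-optimal coefficients are therefore those
    for which a family of such integrals is bounded by given constants, up to
    [1 / n]; they form a decreasing sequence of convex sets.

    Among these sets, nearly minimizing the bounded and strictly convex functional
    [a |-> int 1 / (1 + a)] selects a sequence that converges almost everywhere
    ([nested_convex_ae_cvg]). The constraint given by [u = 0] bounds the integrals
    of the sequence, so its limit is finite, and by Fatou's lemma the limit
    satisfies all the constraints exactly ([convex_lsc_selection]).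

    Test functions in [C10 Omega] may have an unbounded gradient, and for them
    [a |-> int a |grad u|^2] may fail to be upper semicontinuous. They are handled
    by composition with a continuously differentiable soft threshold: the result
    is supported in the compact set [`|u| >= e], its gradient is bounded and
    nowhere larger than that of [u], and it differs from [u] by at most [2 e].
    The infimum defining the functional may thus be taken over functions with
    bounded gradient ([energy_ge_C10]). *)

Set Implicit Arguments.
Unset Strict Implicit.
Unset Printing Implicit Defensive.

Import Order.TTheory GRing.Theory Num.Theory.
Import numFieldNormedType.Exports.

Local Open Scope classical_set_scope.
Local Open Scope ring_scope.

(** * Almost everywhere convergent selections from nested convex sets *)

(** With [p] and [q] the inverses of [1 + x] and [1 + y], the gap in the convexity
    inequality is [2 (p - q)^2 / (p + q)], and [p + q <= 2]. Near-optimality for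
    the integral of [1 / (1 + a)] thus controls an L2 distance. *)
Lemma midpoint_gap_inv1D (R : realFieldType) (x y : R) : 0 <= x -> 0 <= y ->
  4 * (1 + (x + y) / 2)^-1 + ((1 + x)^-1 - (1 + y)^-1) ^+ 2 <=
  2 * (1 + x)^-1 + 2 * (1 + y)^-1.
Proof.
move=> x0 y0.
have xV : (1 + x)^-1 * (1 + x) = 1 by rewrite mulVf//; lra.
have yV : (1 + y)^-1 * (1 + y) = 1 by rewrite mulVf//; lra.
have mV : (1 + (x + y) / 2)^-1 * (1 + (x + y) / 2) = 1 by rewrite mulVf//; lra.
have [p0 p1] : 0 < (1 + x)^-1 /\ (1 + x)^-1 <= 1.
  by split; rewrite ?invr_gt0 ?invf_le1; lra.
have [q0 q1] : 0 < (1 + y)^-1 /\ (1 + y)^-1 <= 1.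
  by split; rewrite ?invr_gt0 ?invf_le1; lra.
move: (1 + x)^-1 (1 + y)^-1 (1 + (x + y) / 2)^-1 xV yV mV p0 p1 q0 q1 => p q m.
move=> xV yV mV p0 p1 q0 q1.
have pqm : m * (p + q) = 2 * (p * q).
  have -> : p + q = p * (q * (1 + y)) + q * (p * (1 + x)) by rewrite xV yV !mulr1.
  transitivity (2 * (p * q) * (m * (1 + (x + y) / 2))); first by lra.
  by rewrite mV mulr1.
have pq0 : 0 < p + q by lra.
rewrite -(ler_pM2r pq0) mulrDl -mulrA pqm.
have : 0 <= (p - q) ^+ 2 * (2 - (p + q)).
  by rewrite mulr_ge0 ?sqr_ge0//; lra.
by lra.
Qed.

Lemma measurable_inv1D d (T : measurableType d) (R : realType) (D : set T)
    (a : T -> R) : measurable D -> (forall x, 0 <= a x) -> measurable_fun D a ->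
  measurable_fun D (fun x => (1 + a x)^-1).
Proof.
move=> mD a0 ma.
apply: (@measurable_comp _ _ _ T R R `]0, +oo[%classic (fun y : R => y^-1)
  D (fun x => 1 + a x)).
- exact: measurable_itv.
- by move=> _ [x Dx <-] /=; rewrite in_itv/= andbT ltr_wpDr.
- apply: open_continuous_measurable_fun; first exact: interval_open.
  move=> y; rewrite inE /= in_itv/= andbT => y0.
  by apply: inv_continuous; rewrite gt_eqF.
- exact: measurable_funD.
Qed.

Lemma cvgn_summable_increments (R : realType) (u : R ^nat) :
  (\sum_(0 <= n <oo) (`|u n - u n.+1|)%:E < +oo)%E -> cvgn u.
Proof.
set s := (X in (X < _)%E) => soo.
have s0 : (0 <= s)%E by apply: nneseries_ge0 => n _ _; rewrite lee_fin.
have sfin : s \is a fin_num by rewrite ge0_fin_numE.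
have ct : cvgn (series (telescope u)).
  apply: normed_cvg; apply: nondecreasing_is_cvgn.
    by apply: nondecreasing_series => n _ _ /=.
  exists (fine s) => _ [n _ <-] /=.
  rewrite /series /= -lee_fin fineK// -sumEFin.
  under eq_bigr do rewrite /telescope distrC.
  by apply: nneseries_lim_ge => k _ _; rewrite lee_fin.
have -> : u = (fun n => u 0%N + series (telescope u) n).
  by apply/funext => n; exact: eq_sum_telescope.
by apply: is_cvgD => //; exact: is_cvg_cst.
Qed.

Section komlos.
Context d (T : measurableType d) (R : realType)
  (mu : {measure set T -> \bar R}) (D : set T).
Hypotheses (mD : measurable D) (muD : (mu D < +oo)%E).

Let p (a : T -> R) x := (1 + a x)^-1.
Let J (a : T -> R) := fine (\int[mu]_(x in D) (p a x)%:E).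

Let muE : mu D = (fine (mu D))%:E.
Proof. by rewrite fineK// ge0_fin_numE. Qed.

Let good (a : T -> R) := measurable_fun D a /\ forall x, 0 <= a x.

Let p0 a x : good a -> 0 <= p a x.
Proof. by case=> _ a0; rewrite invr_ge0 addr_ge0. Qed.

Let p1 a x : good a -> p a x <= 1.
Proof. by case=> _ a0; rewrite invf_le1 ?lerDl ?ltr_wpDr. Qed.

Let mp a : good a -> measurable_fun D (p a).
Proof. by case=> ma a0; exact: measurable_inv1D. Qed.

Let pM a : good a -> (\int[mu]_(x in D) (p a x)%:E <= mu D)%E.
Proof.
move=> ga; rewrite -[leRHS]mul1e -integral_cst//.
apply: ge0_le_integral => //.
- by move=> x _; rewrite lee_fin p0.
- by apply/measurable_EFinP; exact: mp.
- by move=> x _; rewrite lee_fin p1.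
Qed.

Let JE a : good a -> (\int[mu]_(x in D) (p a x)%:E = (J a)%:E)%E.
Proof.
move=> ga; rewrite fineK// ge0_fin_numE ?(le_lt_trans (pM ga))//.
by apply: integral_ge0 => x _; rewrite lee_fin p0.
Qed.

Let J0 a : good a -> 0 <= J a.
Proof.
by move=> ga; rewrite -lee_fin -JE//; apply: integral_ge0 => x _; rewrite lee_fin p0.
Qed.

Let J_midpoint a b : good a -> good b -> good (fun x => (a x + b x) / 2) ->
  (\int[mu]_(x in D) ((p a x - p b x) ^+ 2)%:E <=
   (2 * J a + 2 * J b - 4 * J (fun x => ((a x + b x) / 2)%R))%:E)%E.
Proof.
move=> ga gb gm.
rewrite EFinB leeBrDr//.
have ge0 (k : R) c x : 0 <= k -> good c -> D x -> (0 <= k%:E * (p c x)%:E)%E.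
  by move=> k0 gc _; rewrite mule_ge0 ?lee_fin// p0.
have mk (k : R) c : good c -> measurable_fun D (fun x => k%:E * (p c x)%:E)%E.
  by move=> gc; apply/measurable_EFinP; apply: measurable_funM => //; exact: mp.
have ms : measurable_fun D (fun x => ((p a x - p b x) ^+ 2)%:E).
  by apply/measurable_EFinP; apply: measurable_funX; apply: measurable_funB; exact: mp.
have ZE (k : R) c : 0 <= k -> good c ->
    ((k * J c)%:E = \int[mu]_(x in D) (k%:E * (p c x)%:E))%E.
  move=> k0 gc; rewrite ge0_integralZl ?lee_fin// ?JE//.
    by apply/measurable_EFinP; exact: mp.
  by move=> x _; rewrite lee_fin p0.
rewrite EFinD !ZE// -!ge0_integralD//; try (by move=> x; exact: ge0);
  try exact: mk; last by move=> x _; rewrite lee_fin sqr_ge0.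
apply: ge0_le_integral => //.
- by move=> x Dx; rewrite adde_ge0 ?ge0// lee_fin sqr_ge0.
- by apply: emeasurable_funD => //; exact: mk.
- by apply: emeasurable_funD; exact: mk.
- move=> x _; rewrite -!EFinM -!EFinD lee_fin addrC.
  by case: ga gb => [_ a0] [_ b0]; exact: midpoint_gap_inv1D.
Qed.

(** The infimum of [J] over [A n] is nondecreasing in [n] and bounded by [mu D], so
    it tends to some [s]. Take [g n] nearly optimal in some late [A m]. The midpoint
    of [g n] and [g n.+1] lies in one of these late sets, where [J] cannot be much
    below [s], so the midpoint gap bounds the L2 distance between [1 / (1 + g n)]
    and [1 / (1 + g n.+1)]. With tolerances decreasing geometrically, these
    increments are almost everywhere summable. *)
Lemma nested_convex_ae_cvg (A : nat -> set (T -> R)) :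
    (forall n, A n !=set0) ->
    (forall n m, (n <= m)%N -> A m `<=` A n) ->
    (forall n a b, A n a -> A n b -> A n (fun x => (a x + b x) / 2)) ->
    (forall n a, A n a -> measurable_fun D a /\ forall x, 0 <= a x) ->
  exists2 g : nat -> T -> R, forall n, A n (g n) &
    {ae mu, forall x, D x -> cvgn (fun n => (1 + g n x)^-1)}.
Proof.
move=> A0 ndA cvxA Agood.
pose j n := inf (J @` A n).
have hasinf n : has_inf (J @` A n).
  split; first by have [a Aa] := A0 n; exists (J a), a.
  by exists 0 => _ [a /Agood ga <-]; exact: J0.
have jM n : j n <= fine (mu D).
  have [a Aa] := A0 n; apply: (@le_trans _ _ (J a)).
    by apply: ge_inf; [exact: (hasinf n).2|exists a].
  by rewrite -lee_fin -JE ?(le_trans (pM _)) -?muE//; exact: Agood Aa.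
have hassup : has_sup (range j).
  by split; [exists (j 0%N), 0%N|exists (fine (mu D)) => _ [n _ <-]].
have ndj n m : (n <= m)%N -> j n <= j m.
  move=> nm; apply: lb_le_inf; first exact: (hasinf m).1.
  move=> _ [a Aa <-]; apply: ge_inf; first exact: (hasinf n).2.
  by exists a => //; exact: ndA Aa.
pose s := sup (range j).
pose h k : R := (2 ^ (k + 1))%:R^-1.
have h0 k : 0 < h k by rewrite invr_gt0 ltr0n expn_gt0.
have hn k : h k.+1 <= h k.
  rewrite lef_pV2 ?posrE ?ltr0n ?expn_gt0// ler_nat.
  by rewrite leq_exp2l// leq_add2r.
have H k : exists na : nat * (T -> R), [/\ (k <= na.1)%N, A na.1 na.2,
    s - (h k) ^+ 2 <= j na.1 & J na.2 <= s + (h k) ^+ 2].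
  have hk : 0 < h k ^+ 2 by rewrite exprn_gt0.
  have [_ [n _ <-] nP] := sup_adherent hk hassup.
  pose m := maxn k n.
  have [_ [a Aa <-] aP] := inf_adherent hk (hasinf m).
  exists (m, a); split => //=; first exact: leq_maxl.
    by apply: (le_trans (ltW nP)); apply: ndj; exact: leq_maxr.
  apply: (le_trans (ltW aP)); rewrite lerD2r.
  by apply: ub_le_sup; [exact: hassup.2|exists m].
have [na naP] := choice H.
pose g k := (na k).2.
have Ag k : A k (g k) by have [kn Aa _ _] := naP k; exact: ndA Aa.
have gg k : good (g k) by exact: Agood (Ag k).
exists g => //.
have sq k : (\int[mu]_(x in D) ((p (g k) x - p (g k.+1) x) ^+ 2)%:E <=
             (8 * h k ^+ 2)%:E)%E.
  have [kn Aa jk Jk] := naP k; have [kn' Aa' jk' Jk'] := naP k.+1.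
  pose m := minn (na k).1 (na k.+1).1.
  have hh : h k.+1 ^+ 2 <= h k ^+ 2.
    by apply: lerXn2r; rewrite ?nnegrE ?(ltW (h0 _)).
  have jm : s - h k ^+ 2 <= j m.
    rewrite /m; case: (leqP (na k).1 (na k.+1).1) => // _.
    by apply: le_trans jk'; rewrite lerB.
  have Am : A m (fun x => (g k x + g k.+1 x) / 2).
    by apply: cvxA; [apply: ndA Aa; exact: geq_minl|apply: ndA Aa'; exact: geq_minr].
  have Jm : j m <= J (fun x => (g k x + g k.+1 x) / 2).
    by apply: ge_inf; [exact: (hasinf m).2|exists (fun x => (g k x + g k.+1 x) / 2)].
  apply: (le_trans (J_midpoint (gg k) (gg k.+1) (Agood _ _ Am))).
  rewrite lee_fin; rewrite -/(g k) -/(g k.+1) in Jk Jk' *.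
  by lra.
pose dd k x : R := `|p (g k) x - p (g k.+1) x|.
have mdd k : measurable_fun D (fun x => (dd k x)%:E).
  apply/measurable_EFinP; apply: measurableT_comp => //.
  by apply: measurable_funB; exact: mp.
have i_dd k : (\int[mu]_(x in D) (dd k x)%:E <= (h k * (fine (mu D) + 8))%:E)%E.
  have ms : measurable_fun D (fun x => ((p (g k) x - p (g k.+1) x) ^+ 2)%:E).
    by apply/measurable_EFinP; apply: measurable_funX; apply: measurable_funB; exact: mp.
  (* [t <= h + t^2 / h] turns the L2 bound into an L1 bound of order [h]. *)
  apply: (@le_trans _ _ (\int[mu]_(x in D) ((h k)%:E +
      (h k)^-1%:E * ((p (g k) x - p (g k.+1) x) ^+ 2)%:E))%E).
    apply: ge0_le_integral => //.
    - by move=> x _; rewrite lee_fin normr_ge0.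
    - by apply: emeasurable_funD => //; exact: measurable_funeM.
    move=> x _; rewrite -EFinM -EFinD lee_fin /dd -real_normK ?num_real//.
    set t := `|_|; have t0 : 0 <= t by exact: normr_ge0.
    have [th|th] := leP t (h k).
      by rewrite ler_wpDr// mulr_ge0 ?sqr_ge0// invr_ge0 ltW.
    rewrite ler_wpDl ?(ltW (h0 k))// expr2 mulrA ler_peMl// mulrC.
    by rewrite ler_pdivlMr// mul1r ltW.
  rewrite ge0_integralD//; last 3 first.
    by move=> x _; rewrite lee_fin ltW.
    by move=> x _; rewrite mule_ge0 ?lee_fin ?sqr_ge0// invr_ge0 ltW.
    exact: measurable_funeM.
  rewrite integral_cst// mulrDr EFinD leeD//; first by rewrite {1}muE.
  rewrite ge0_integralZl//; last 2 first.
    by move=> x _; rewrite lee_fin sqr_ge0.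
    by rewrite lee_fin invr_ge0 ltW.
  apply: (le_trans (lee_wpmul2l _ (sq k))); first by rewrite lee_fin invr_ge0 ltW.
  rewrite -EFinM (_ : (h k)^-1 * _ = h k * 8)//.
  by rewrite mulrCA expr2 mulKf ?gt_eqF// mulrC.
have fin : (\int[mu]_(x in D) (\sum_(0 <= k <oo) (dd k x)%:E) < +oo)%E.
  rewrite integral_nneseries//; last by move=> k x _; rewrite lee_fin normr_ge0.
  apply: (@le_lt_trans _ _
      (\sum_(0 <= k <oo) ((fine (mu D) + 8) / (2 ^ (k + 1))%:R)%:E)%E).
    apply: lee_nneseries => [k _ _|k _].
      by apply: integral_ge0 => x _; rewrite lee_fin normr_ge0.
    by apply: (le_trans (i_dd k)); rewrite mulrC.
  have /cvg_lim := @cvg_geometric_eseries_half R (fine (mu D) + 8) 0.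
  by move=> ->//; rewrite ltry.
have : mu.-integrable D (fun x => \sum_(0 <= k <oo) (dd k x)%:E)%E.
  apply/integrableP; split.
    by apply: ge0_emeasurable_sum => // k x _ _; rewrite lee_fin normr_ge0.
  under eq_integral.
    move=> x _; rewrite gee0_abs; last first.
      by apply: nneseries_ge0 => k _ _; rewrite lee_fin normr_ge0.
    over.
  exact: fin.
move/(integrable_ae mD); apply: filterS => x /= + Dx => /(_ Dx) xfin.
apply: cvgn_summable_increments; rewrite -ge0_fin_numE//.
by apply: nneseries_ge0 => k _ _; rewrite lee_fin normr_ge0.
Qed.

End komlos.

(** * Lower semicontinuity along almost everywhere convergence *)

Lemma lower_semicontinuousMD (R : realType) (f : R -> \bar R) (c : R) (b : R -> R) :
  0 < c -> (forall s, (0 <= f s)%E) -> lower_semicontinuous f -> continuous b ->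
  lower_semicontinuous (fun s => c%:E * f s + (b s)%:E)%E.
Proof.
move=> c0 f0 lf cb x a afx.
have [r rf ar] : exists2 r, (r%:E < f x)%E & a < c * r + b x.
  move: afx (f0 x); case: (f x) => [y + _| _ _|//].
    rewrite -EFinM -EFinD lte_fin => ay.
    exists (y - (c * y + b x - a) / 2 / c).
      by rewrite lte_fin ltrBlDr ltrDl !divr_gt0// subr_gt0.
    by rewrite mulrBr [c * (_ / c)]mulrC divfK ?gt_eqF//; lra.
  exists ((a - b x) / c + 1); first exact: ltry.
  by rewrite mulrDr [c * (_ / c)]mulrC divfK ?gt_eqF//; lra.
have [V xV Vf] := lf x r rf.
exists (V `&` [set y | a - c * r < b y]).
  have abx : a - c * r < b x by rewrite ltrBlDl.
  by apply: filterI => //; exact: (cvgr_gt _ (cb x) _ abx).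
move=> y [/Vf ry /= aby].
apply: (@lt_le_trans _ _ (c * r + b y)%:E); first by rewrite lte_fin -ltrBlDl.
by rewrite EFinD leeD2r// EFinM lee_pmul2l// ltW.
Qed.

Lemma limn_einf_le (R : realType) (u : (\bar R)^nat) (c : \bar R) :
  (\forall n \near \oo, (u n <= c)%E) -> (limn_einf u <= c)%E.
Proof.
move=> uc; rewrite limn_einf_lim; apply: lime_le; first exact: is_cvg_einfs.
near=> n; apply: (@le_trans _ _ (u n)); last by near: n.
by apply: ereal_inf_lbound; exists n => /=.
Unshelve. all: by end_near. Qed.

Lemma limn_einf_ge (R : realType) (u : (\bar R)^nat) (c : \bar R) :
  (\forall n \near \oo, (c <= u n)%E) -> (c <= limn_einf u)%E.
Proof.
move=> [N _ cu]; rewrite limn_einf_lim; apply: lime_ge; first exact: is_cvg_einfs.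
exists N => // n Nn; apply: le_ereal_inf_tmp => _ [m /= nm <-].
by apply: cu => /=; exact: leq_trans nm.
Qed.

Lemma lower_semicontinuous_limn_einf (R : realType) (f : R -> \bar R)
    (s : R^nat) (l : R) : lower_semicontinuous f -> s @ \oo --> l ->
  (f l <= limn_einf (fun n => f (s n)))%E.
Proof.
move=> lf sl.
have ge (b : R) : (b%:E < f l)%E -> (b%:E <= limn_einf (fun n => f (s n)))%E.
  move=> /lf[V lV fV]; apply: limn_einf_ge.
  by have [N _ NV] := sl _ lV; exists N => // n /NV Vsn; exact/ltW/fV.
case E : (f l) => [r| |]; last exact: leNye.
- apply/lee_subgt0Pr => e e0; rewrite -EFinB; apply: ge.
  by rewrite E lte_fin ltrBlDr ltrDl.
- by rewrite leye_eq; apply/eqP/eq_infty => b; apply: ge; rewrite E ltry.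
Qed.

Section selection.
Context d (T : measurableType d) (R : realType)
  (mu : {measure set T -> \bar R}) (D : set T).
Hypotheses (mD : measurable D) (muD : (mu D < +oo)%E).

Lemma measurable_fun_limn_einf (u : (T -> \bar R)^nat) :
  (forall n, measurable_fun D (u n)) ->
  measurable_fun D (fun x => limn_einf (u^~ x)).
Proof.
move=> mu_; rewrite (_ : (fun _ => _) =
    (fun x => - limn_esup (fun n => - u n x))%E); last first.
  by apply/funext => x; rewrite -[RHS]limn_einfN; congr limn_einf;
    apply/funext => n /=; rewrite oppeK.
apply: measurableT_comp => //.
apply: (measurable_fun_limn_esup (f := fun n x => - u n x)%E).
by move=> n; exact: measurableT_comp.
Qed.

(** If [1 / (1 + s n)] tends to [0] then [s] tends to infinity, which the
    finiteness of the lower limit excludes. The absolute value makes the limit of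
    a sequence of functions nonnegative at every point, also where the sequence
    diverges. *)
Lemma cvg_of_cvg_inv1D (s : R^nat) : (forall n, 0 <= s n) ->
  cvgn (fun n => (1 + s n)^-1) -> limn_einf (EFin \o s) \is a fin_num ->
  s @ \oo --> `|fine (limn_einf (EFin \o s))|.
Proof.
move=> s0 cs.
have s1 n : 0 < 1 + s n by rewrite ltr_wpDr.
have [l0|l0] := eqVneq (limn (fun n => (1 + s n)^-1)) 0.
  have : (fun n => (1 + s n)) @ \oo --> +oo.
    apply/(@gtr0_cvgV0 _ _ _ _ (fun n => 1 + s n)); first exact: nearW.
    by rewrite -l0.
  move/cvgeryP/cvg_limn_einf_sup => [+ _].
  under [X in limn_einf X]funext do rewrite EFinD.
  rewrite limn_einf_shift//; by case: (limn_einf _).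
have sl : s @ \oo --> (limn (fun n => (1 + s n)^-1))^-1 - 1.
  rewrite [X in X @ \oo --> _](_ : _ = fun n => ((1 + s n)^-1)^-1 - 1).
    by apply: cvgB; [exact: cvgV|exact: cvg_cst].
  by apply/funext => n; rewrite invrK addrAC subrr add0r.
move=> _; have /cvg_limn_einf_sup [-> _] : EFin \o s @ \oo -->
    ((limn (fun n => (1 + s n)^-1))^-1 - 1)%:E.
  by apply: cvg_EFin => //; exact: nearW.
rewrite /= ger0_norm//.
have <- := cvg_lim (@Rhausdorff R) sl.
by apply: limr_ge; [apply/cvg_ex; eexists; exact: sl|exact: nearW].
Qed.

Variables (I : Type) (F : I -> T -> R -> \bar R) (kappa : I -> R) (i0 : I).
Hypothesis F0 : forall i x (s : R), D x -> 0 <= s -> (0 <= F i x s)%E.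
Hypothesis mF : forall i (a : T -> R), measurable_fun D a -> (forall x, 0 <= a x) ->
  measurable_fun D (fun x => F i x (a x)).
Hypothesis F_midpoint : forall i x (s t : R), D x -> 0 <= s -> 0 <= t ->
  (F i x ((s + t) / 2)%R <= 2^-1%:E * F i x s + 2^-1%:E * F i x t)%E.
Hypothesis F_lsc : forall i x, D x -> lower_semicontinuous (F i x).
Hypothesis F_coercive : forall x (s : R), D x -> 0 <= s -> (s%:E <= F i0 x s)%E.

(** The functions that satisfy all constraints up to [1 / n] form nested
    midpoint-convex sets, so some choice of them converges almost everywhere in
    [[0, +oo]]. The coercive integrand [F i0] bounds their integrals, hence makes
    the limit finite, and Fatou's lemma passes each constraint to the limit. *)
Lemma convex_lsc_selection :
  (forall e, 0 < e -> exists a : T -> R, [/\ measurable_fun D a, forall x, 0 <= a x &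
     forall i, (\int[mu]_(x in D) F i x (a x) <= (kappa i + e)%:E)%E]) ->
  exists a : T -> R, [/\ measurable_fun D a, forall x, 0 <= a x &
     forall i, (\int[mu]_(x in D) F i x (a x) <= (kappa i)%:E)%E].
Proof.
move=> approx.
pose A n := [set a : T -> R | [/\ measurable_fun D a, forall x, 0 <= a x &
     forall i, (\int[mu]_(x in D) F i x (a x) <= (kappa i + n.+1%:R^-1)%:E)%E]].
have [g Ag gcvg] : exists2 g : nat -> T -> R, forall n, A n (g n) &
    {ae mu, forall x, D x -> cvgn (fun n => (1 + g n x)^-1)}.
  apply: nested_convex_ae_cvg => //.
  - by move=> n; have [|a ?] := approx n.+1%:R^-1; [|exists a].
  - move=> n m nm a [ma a0 aA]; split => // i; apply: (le_trans (aA i)).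
    by rewrite lee_fin lerD2l lef_pV2 ?posrE// ler_nat.
  - move=> n a b [ma a0 aA] [mb b0 bA]; split.
    + by apply: measurable_funM => //; exact: measurable_funD.
    + by move=> x; rewrite divr_ge0// addr_ge0.
    + move=> i; apply: (@le_trans _ _ (\int[mu]_(x in D)
          (2^-1%:E * F i x (a x) + 2^-1%:E * F i x (b x)))%E).
        apply: ge0_le_integral => //.
        * by move=> x Dx; apply: F0 => //; rewrite divr_ge0// addr_ge0.
        * apply: (@mF i (fun x => (a x + b x) / 2)).
            by apply: measurable_funM => //; exact: measurable_funD.
          by move=> x; rewrite divr_ge0// addr_ge0.
        * by apply: emeasurable_funD; apply: measurable_funeM; exact: mF.
        * by move=> x Dx; exact: F_midpoint.
      rewrite ge0_integralD//; first last.
      * by apply: measurable_funeM; exact: mF.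
      * by move=> x Dx; rewrite mule_ge0 ?F0// lee_fin invr_ge0.
      * by apply: measurable_funeM; exact: mF.
      * by move=> x Dx; rewrite mule_ge0 ?F0// lee_fin invr_ge0.
      rewrite !ge0_integralZl ?lee_fin ?invr_ge0//; try exact: mF;
        try by move=> x Dx; exact: F0.
      apply: (@le_trans _ _ (2^-1%:E * (kappa i + n.+1%:R^-1)%:E +
          2^-1%:E * (kappa i + n.+1%:R^-1)%:E)%E).
        by apply: leeD; apply: lee_wpmul2l; rewrite ?lee_fin ?invr_ge0.
      by rewrite -!EFinM -EFinD lee_fin; move: (kappa i + _) => c; lra.
  - by move=> n a [].
have mg n : measurable_fun D (g n) by have [] := Ag n.
have g0 n x : 0 <= g n x by have [] := Ag n.
pose G x := limn_einf (fun n => (g n x)%:E).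
have mG : measurable_fun D G.
  by apply: measurable_fun_limn_einf => n; exact/measurable_EFinP.
have G0 x : (0 <= G x)%E.
  by apply: limn_einf_ge; apply: nearW => n; rewrite lee_fin.
have iG : mu.-integrable D G.
  apply/integrableP; split => //.
  under eq_integral do rewrite gee0_abs//.
  apply: (@le_lt_trans _ _ (kappa i0 + 1)%:E); last exact: ltry.
  apply: (le_trans (fatou mu mD _ _)).
  - by move=> n; exact/measurable_EFinP.
  - by move=> n x _; rewrite lee_fin.
  apply: limn_einf_le; apply: nearW => n.
  have [_ _ /(_ i0)] := Ag n; set r := (X in (_ <= X)%E) => gn.
  apply: (@le_trans _ _ r); last first.
    by rewrite lee_fin lerD2l invf_le1// ler1n.
  apply: le_trans gn; apply: ge0_le_integral => //.
  - by move=> x _; rewrite lee_fin.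
  - exact/measurable_EFinP.
  - exact: mF.
  - by move=> x Dx; exact: F_coercive.
pose aopt x := `|fine (G x)|.
have ma : measurable_fun D aopt.
  have mfG : measurable_fun D (fine \o G).
    by apply: measurableT_comp => //; exact: fine_measurable.
  exact: measurableT_comp mfG.
have a0 x : 0 <= aopt x by exact: normr_ge0.
have ga : {ae mu, forall x, D x -> g n x @[n --> \oo] --> aopt x}.
  have := integrable_ae mD iG; apply: filterS2 gcvg => x gx Gx Dx.
  by apply: cvg_of_cvg_inv1D; [|exact: gx|exact: Gx].
exists aopt; split => // i.
apply: (@le_trans _ _ (\int[mu]_(x in D) limn_einf (fun n => F i x (g n x)))%E).
  apply: ae_ge0_le_integral => //.
  - by move=> x Dx; exact: F0.
  - exact: mF.
  - by move=> x Dx; apply: limn_einf_ge; apply: nearW => n; exact: F0.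
  - by apply: measurable_fun_limn_einf => n; exact: mF.
  apply: filterS ga => x gx Dx.
  by apply: lower_semicontinuous_limn_einf; [exact: F_lsc|exact: gx].
apply: (le_trans (fatou mu mD _ _)).
- by move=> n; exact: mF.
- by move=> n x Dx; exact: F0.
apply/lee_addgt0Pr => e e0; rewrite -EFinD.
apply: limn_einf_le; near=> n.
have [_ _ /(_ i) gn] := Ag n; apply: (le_trans gn).
by rewrite lee_fin lerD2l ltW//; near: n; exact: near_infty_natSinv_lt (PosNum e0).
Unshelve. all: by end_near. Qed.

End selection.

(** * Borel functions and bounded sets in Euclidean space *)

Lemma open_setI_preimage (T S : topologicalType) (U : set T) (V : set S)
    (g : T -> S) : open U -> open V ->
  (forall x, U x -> {for x, continuous g}) -> open (U `&` g @^-1` V).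
Proof.
move=> oU oV cg; rewrite openE => x [Ux Vgx]; apply: filterI.
  exact: open_nbhs_nbhs.
by apply: (cg x Ux); exact: open_nbhs_nbhs.
Qed.

Section euclidean_space.
Context {R : realType} {d : nat}.
Implicit Types (U : set 'rV[R]_d) (g : 'rV[R]_d -> R).

Lemma continuous_measurable_rV U g : open U ->
  (forall x, U x -> {for x, continuous g}) -> measurable_fun U g.
Proof.
move=> oU cg; apply: (measurability _ (RGenOpens.measurableE R)).
move=> _ [_ [a [b ->] <-]]; apply: open_measurable_rV.
by apply: open_setI_preimage => //; exact: interval_open.
Qed.

End euclidean_space.

Lemma coord_le_norm_rV (R : realType) (d : nat) (v : 'rV[R]_d) (j : 'I_d) :
  `|v 0 j| <= `|v|.
Proof.
by rewrite [leRHS]/Num.norm /= mx_normrE; apply/bigmax_geP; right => /=; exists (0, j).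
Qed.

Section lebesgue_bounded.
Context {R : realType}.

Definition box (d : nat) (M : R) : set 'rV[R]_d := [set v | forall j, `|v 0 j| <= M].
Arguments box : clear implicits.

Lemma measurable_box d M : measurable (box d M).
Proof.
rewrite (_ : box d M = \bigcap_(j in [set: 'I_d])
    (fun v : 'rV[R]_d => v 0 j : measurableTypeR R) @^-1` `[- M, M]%classic).
  apply: fin_bigcap_measurable => [|j _]; first exact: finite_finset.
  by rewrite -[X in measurable X]setTI; exact: measurable_coord_rV.
apply/seteqP; split => v /= h j.
  by move=> _ /=; rewrite in_itv/= -ler_norml.
by rewrite ler_norml; have := h j I; rewrite /= in_itv.
Qed.

Lemma lebesgue_box_fin d M : (lebesgue_rV d (box d M) < +oo)%E.
Proof.
elim: d => [|d IH]; first by rewrite /= diracE; case: (_ \in _); rewrite ltry.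
rewrite /= /lebesgue_step /pushforward.
rewrite (_ : _ @^-1` _ = `[- M, M]%classic `*` box d M); last first.
  apply/seteqP; split => [[x v] /= h|[x v] [/= xM vM] j].
    split => /=.
      by have := h 0; rewrite row_consE unlift_none/= in_itv/= -ler_norml.
    by move=> j; have := h (lift ord0 j); rewrite row_consE liftK.
  rewrite row_consE; case: unliftP => [k|] _ /=; first exact: (vM k).
  by rewrite ler_norml; move: xM; rewrite in_itv.
rewrite [ltLHS]product_measure1E//; last exact: measurable_box.
rewrite lte_mul_pinfty//.
rewrite ge0_fin_numE//= lebesgue_measure_itv/=; case: ifP => _; last exact: ltry.
by rewrite -EFinD ltry.
Qed.

Lemma lebesgue_bounded_fin d (A : set 'rV[R]_d) :
  measurable A -> bounded_set A -> (lebesgue_rV d A < +oo)%E.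
Proof.
move=> mA /ex_strict_bound_gt0[M M0 AM].
apply: (le_lt_trans _ (lebesgue_box_fin d M)); apply: le_measure;
  rewrite ?inE //; first exact: measurable_box.
move=> v Av j; apply: le_trans (ltW (AM _ Av)); exact: coord_le_norm_rV.
Qed.

End lebesgue_bounded.

(** * A continuously differentiable soft threshold *)

Section soft_threshold.
Context {R : realType}.
Implicit Types e t h : R.

Definition sqr_ramp (w : R) : R := Num.max w 0 ^+ 2.

Lemma sqr_ramp_remainder (w h : R) :
  0 <= sqr_ramp (w + h) - sqr_ramp w - 2 * Num.max w 0 * h <= h ^+ 2.
Proof.
rewrite /sqr_ramp; apply/andP.
by case: (leP w 0) => w0; case: (leP (w + h) 0) => wh0; split; nra.
Qed.

Definition huber e w : R := (sqr_ramp w - sqr_ramp (w - e)) / (2 * e).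

Definition huber' e w : R := (Num.max w 0 - Num.max (w - e) 0) / e.

Lemma huber_eq0 e w : 0 < e -> w <= 0 -> huber e w = 0.
Proof. by move=> e0 w0; rewrite /huber /sqr_ramp !max_r; lra. Qed.

Lemma huber'_eq0 e w : 0 < e -> w <= 0 -> huber' e w = 0.
Proof. by move=> e0 w0; rewrite /huber' !max_r; lra. Qed.

Lemma huber_itv e w : 0 < e -> 0 <= w -> w - e <= huber e w <= w.
Proof.
move=> e0 w0; have e2 : 0 < 2 * e by rewrite mulr_gt0.
rewrite /huber /sqr_ramp ler_pdivlMr// ler_pdivrMr// (max_l w0); apply/andP.
by case: (leP (w - e) 0) => ?; split; nra.
Qed.

Lemma huber_ge0 e w : 0 < e -> 0 <= huber e w.
Proof.
move=> e0; rewrite /huber /sqr_ramp ler_pdivlMr ?mulr_gt0// mul0r.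
by case: (leP w 0) => ?; case: (leP (w - e) 0) => ?; nra.
Qed.

Lemma huber'_itv e w : 0 < e -> 0 <= huber' e w <= 1.
Proof.
move=> e0; rewrite /huber' ler_pdivlMr// ler_pdivrMr// mul0r mul1r; apply/andP.
by case: (leP w 0) => ?; case: (leP (w - e) 0) => ?; split; lra.
Qed.

Lemma huber_remainder e w h : 0 < e ->
  `|huber e (w + h) - huber e w - huber' e w * h| <= h ^+ 2 / (2 * e).
Proof.
move=> e0; have e2 : 0 < 2 * e by rewrite mulr_gt0.
have /andP[a1 a2] := sqr_ramp_remainder w h.
have /andP[b1 b2] := sqr_ramp_remainder (w - e) h.
have -> : huber e (w + h) - huber e w - huber' e w * h =
  ((sqr_ramp (w + h) - sqr_ramp w - 2 * Num.max w 0 * h) -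
   (sqr_ramp (w - e + h) - sqr_ramp (w - e) - 2 * Num.max (w - e) 0 * h)) / (2 * e).
  by rewrite /huber /huber' [w + h - e]addrAC invfM; lra.
rewrite normrM [`|(2 * e)^-1|]gtr0_norm ?invr_gt0// ler_pM2r ?invr_gt0//.
by rewrite ler_norml; apply/andP; split; lra.
Qed.

(** A continuously differentiable soft threshold: it vanishes on [[- e, e]] and has
    slope [1] outside [[- 2 e, 2 e]]. *)
Definition soft e t : R := huber e (t - e) - huber e (- t - e).

Definition soft' e t : R := huber' e (t - e) + huber' e (- t - e).

Lemma soft'_itv e t : 0 < e -> 0 <= soft' e t <= 1.
Proof.
move=> e0; rewrite /soft'.
have [te|te] := leP t 0.
  by rewrite (huber'_eq0 (w := t - e)) ?add0r ?huber'_itv//; lra.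
by rewrite (huber'_eq0 (w := - t - e)) ?addr0 ?huber'_itv//; lra.
Qed.

Lemma soft'_eq0 e t : 0 < e -> `|t| <= e -> soft' e t = 0.
Proof.
rewrite ler_norml /soft' => e0 /andP[te et].
by rewrite !huber'_eq0 ?addr0//; lra.
Qed.

Lemma soft_itv e t : 0 < e -> 0 <= t -> 0 <= soft e t <= t /\ t - 2 * e <= soft e t.
Proof.
move=> e0 t0; rewrite /soft (huber_eq0 (w := - t - e)) ?subr0//; last by lra.
rewrite huber_ge0//=; have [te|te] := leP t e.
  by rewrite huber_eq0//; lra.
have te0 : 0 <= t - e by lra.
by have /andP[] := huber_itv e0 te0; lra.
Qed.

Lemma softN e t : soft e (- t) = - soft e t.
Proof. by rewrite /soft opprK opprB. Qed.

Lemma soft_le e t : 0 < e -> `|soft e t| <= `|t|.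
Proof.
move=> e0; wlog t0 : t / 0 <= t.
  move=> H; have [|t0] := leP 0 t; first exact: H.
  by rewrite -(normrN t) -(normrN (soft _ _)) -softN H// oppr_ge0 ltW.
by have [/andP[s0 st] _] := soft_itv e0 t0; rewrite !ger0_norm.
Qed.

Lemma soft_dist e t : 0 < e -> `|soft e t - t| <= 2 * e.
Proof.
move=> e0; wlog t0 : t / 0 <= t.
  move=> H; have [|t0] := leP 0 t; first exact: H.
  by have := H (- t); rewrite softN -opprD normrN; apply; rewrite oppr_ge0 ltW.
have [/andP[s0 st] ts] := soft_itv e0 t0.
by rewrite ler_norml; apply/andP; split; lra.
Qed.

(** One uniform estimate gives the derivative of a piecewise formula, its junction
    points included. *)
Lemma is_derive_quadratic_remainder (f : R -> R) (t l C : R) :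
  (forall h, `|f (t + h) - f t - l * h| <= C * h ^+ 2) -> is_derive t 1 f l.
Proof.
move=> fC.
have fl : h^-1 *: ((f \o shift t) (h *: (1 : R)) - f t) @[h --> 0^'] --> l.
  apply/cvgrPdist_le => eps eps0; near=> h.
  have h0 : h != 0 by near: h; exact: nbhs_dnbhs_neq.
  have hC : `|h| <= eps / (`|C| + 1).
    by near: h; apply: dnbhs0_le; rewrite divr_gt0// ltr_wpDl.
  rewrite /= distrC.
  have -> : h^-1 *: (f (h *: 1 + t) - f t) - l = h^-1 * (f (t + h) - f t - l * h).
    rewrite -[h^-1 *: _]/(h^-1 * (f (h * 1 + t) - f t)) mulr1 [h + t]addrC.
    by rewrite [RHS]mulrBr [h^-1 * (l * h)]mulrCA mulVf// mulr1.
  rewrite normrM normfV.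
  rewrite ler_pdivrMl ?normr_gt0//; apply: (le_trans (fC h)).
  rewrite -real_normK ?num_real// expr2 mulrA.
  rewrite [leRHS]mulrC ler_wpM2r//.
  rewrite ler_pdivlMr ?ltr_wpDl// in hC.
  apply: le_trans hC; rewrite mulrC ler_wpM2l//.
  by rewrite (le_trans (ler_norm _))// lerDl.
by apply: DeriveDef; [apply/cvg_ex; exists l|exact/cvg_lim].
Unshelve. all: by end_near. Qed.

Lemma is_derive_soft e t : 0 < e -> is_derive t 1 (soft e) (soft' e t).
Proof.
move=> e0; apply: (@is_derive_quadratic_remainder _ _ _ e^-1) => h.
have a := huber_remainder (t - e) h e0.
have b := huber_remainder (- t - e) (- h) e0.
have -> : soft e (t + h) - soft e t - soft' e t * h =
  (huber e (t - e + h) - huber e (t - e) - huber' e (t - e) * h) -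
  (huber e (- t - e - h) - huber e (- t - e) - huber' e (- t - e) * - h).
  by rewrite /soft /soft' [t + h - e]addrAC opprD [- t - h - e]addrAC; lra.
apply: (le_trans (ler_normB _ _)); apply: (le_trans (lerD a b)).
by rewrite sqrrN invfM; lra.
Qed.

Lemma continuous_soft' e : continuous (soft' e).
Proof.
have chuber' : continuous (huber' e).
  move=> w; apply: cvgM; last exact: cvg_cst.
  apply: cvgB; first by apply: continuous_max; [exact: cvg_id|exact: cvg_cst].
  apply: (@continuous_max _ _ (fun w => w - e) (fun=> 0)); last exact: cvg_cst.
  by apply: cvgB; [exact: cvg_id|exact: cvg_cst].
move=> t; apply: cvgD.
  apply: (@continuous_comp _ _ _ (fun t => t - e) (huber' e)); last exact: chuber'.
  by apply: cvgB; [exact: cvg_id|exact: cvg_cst].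
apply: (@continuous_comp _ _ _ (fun t => - t - e) (huber' e)); last exact: chuber'.
by apply: cvgB; [apply: cvgN; exact: cvg_id|exact: cvg_cst].
Qed.

End soft_threshold.

(** * Functions vanishing on the boundary *)

Section C10_functions.
Context {R : realType} {d : nat}.
Implicit Types (Omega : set 'rV[R]_d) (u : 'rV[R]_d -> R).

Lemma continuous_on_compact_bounded (V : topologicalType) (K : set V) (g : V -> R) :
  compact K -> (forall x, K x -> {for x, continuous g}) ->
  exists2 M, 0 < M & forall x, K x -> `|g x| <= M.
Proof.
move=> cK cg.
have : compact (g @` K).
  apply: continuous_compact cK; apply: continuous_in_subspaceT => x /[1!inE].
  exact: cg.
move=> /compact_bounded/ex_strict_bound_gt0[M M0 gM].
by exists M => // x Kx; apply: ltW; apply: gM; exists x.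
Qed.

Lemma C10_continuous Omega u x : C10 Omega u -> Omega x -> {for x, continuous u}.
Proof. by move=> [du _ _] Ox; exact/differentiable_continuous/du. Qed.

(** A limit of points of the set cannot be a boundary point of [Omega], where [u]
    tends to [0]; so the set is closed. *)
Lemma C10_compact_superlevel Omega u e : bounded_set Omega -> C10 Omega u ->
  0 < e -> compact [set x | Omega x /\ e <= `|u x|].
Proof.
move=> bO Cu e0; apply: bounded_closed_compact.
  case: bO => M [Mreal OM]; exists M; split=> // M' /OM OM' x [Ox _].
  exact: OM'.
move=> x clx.
have small_near : nbhs x [set y | Omega y -> `|u y| < e] -> False.
  by move=> /clx[y [[Oy ey]]] /(_ Oy); rewrite ltNge ey.
have clOx : closure Omega x.
  by move=> B /clx[y [[Oy _] By]]; exists y.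
have [Ox|nOx] := pselect (Omega x); last first.
  exfalso; apply: small_near; have [_ _ /(_ x clOx nOx) ux0] := Cu.
  exact: (cvgr0_norm_lt _ ux0 _ e0).
split=> //; rewrite leNgt; apply/negP => uxe; apply: small_near.
have : \forall y \near x, `|u y| < e.
  exact: (cvgr_norm_lt _ (C10_continuous Cu Ox) _ uxe).
by apply: filterS => y uy _.
Qed.

Lemma C10_bounded Omega u : bounded_set Omega -> C10 Omega u ->
  exists2 M, 0 < M & forall x, Omega x -> `|u x| <= M.
Proof.
move=> bO Cu.
have cK := C10_compact_superlevel bO Cu ltr01.
have [|M M0 uM] := continuous_on_compact_bounded cK (g := u).
  by move=> x [Ox _]; exact: C10_continuous Cu Ox.
exists (M + 1); first by rewrite addr_gt0.
move=> x Ox; have [u1|u1] := leP 1 `|u x|.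
  by rewrite (le_trans (uM x _))// lerDl.
by rewrite (le_trans (ltW u1))// lerDr ltW.
Qed.

Lemma measurable_C10 Omega u : open Omega -> C10 Omega u -> measurable_fun Omega u.
Proof.
by move=> oO Cu; apply: continuous_measurable_rV => // x Ox; exact: C10_continuous Cu Ox.
Qed.

Lemma continuous_sqr_grad Omega u x : C10 Omega u -> Omega x ->
  {for x, continuous (fun x => sqr_eucl_norm (grad u x))}.
Proof.
move=> [_ cgu _] Ox; rewrite /sqr_eucl_norm.
have cj j : {for x, continuous (fun x => grad u x 0 j)}.
  apply: (@continuous_comp _ _ _ (grad u) (fun v : 'rV[R]_d => v 0 j)).
    exact: cgu.
  exact: coord_continuous.
apply: (@cvg_big _ _ _ _ _ (@add_continuous R) _ (nbhs x)) => j _.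
by apply: (@continuousM _ _ (fun y => grad u y 0 j)); exact: cj.
Qed.

Lemma measurable_sqr_grad Omega u : open Omega -> C10 Omega u ->
  measurable_fun Omega (fun x => sqr_eucl_norm (grad u x)).
Proof.
move=> oO Cu; apply: continuous_measurable_rV => // x Ox.
exact: continuous_sqr_grad Cu Ox.
Qed.

Lemma sqr_eucl_norm_ge0 (v : 'rV[R]_d) : 0 <= sqr_eucl_norm v.
Proof. by apply: sumr_ge0 => i _; exact: sqr_ge0. Qed.

Lemma sqr_eucl_normZ c (v : 'rV[R]_d) :
  sqr_eucl_norm (c *: v) = c ^+ 2 * sqr_eucl_norm v.
Proof.
by rewrite /sqr_eucl_norm mulr_sumr; apply: eq_bigr => i _; rewrite mxE exprMn.
Qed.

Lemma grad_comp u (f : R -> R) (l : R) x : differentiable u x ->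
  is_derive (u x) 1 f l -> grad (f \o u) x = l *: grad u x.
Proof.
move=> du fl.
have df : differentiable f (u x) by apply/derivable1_diffP; exact: ex_derive.
apply/rowP => i; rewrite !mxE deriveE; last exact: differentiable_comp.
rewrite diff_comp//= diff1E// derive1E derive_val -deriveE//.
by rewrite /GRing.scale/= mulrC.
Qed.

Lemma grad_soft u e x : 0 < e -> differentiable u x ->
  grad (soft e \o u) x = soft' e (u x) *: grad u x.
Proof. by move=> e0 du; apply: grad_comp => //; exact: is_derive_soft. Qed.

Lemma C10_soft Omega u e : open Omega -> 0 < e -> C10 Omega u ->
  C10 Omega (soft e \o u).
Proof.
move=> oO e0 Cu; have [du cgu u0] := Cu.
have dsoft t : differentiable (soft e) t.
  by apply/derivable1_diffP; case: (is_derive_soft t e0).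
have gE x : Omega x -> grad (soft e \o u) x = soft' e (u x) *: grad u x.
  by move=> Ox; apply: grad_soft => //; exact: du.
split.
- by move=> x Ox; apply: differentiable_comp; [exact: du|exact: dsoft].
- move=> x Ox.
  have cG : soft' e (u y) *: grad u y @[y --> x] --> soft' e (u x) *: grad u x.
    have cs : {for x, continuous (soft' e \o u)}.
      apply: continuous_comp; first exact: C10_continuous Cu Ox.
      exact: continuous_soft'.
    exact: (cvgZ cs (cgu x Ox)).
  suff : grad (soft e \o u) y @[y --> x] --> soft' e (u x) *: grad u x.
    by rewrite -gE.
  apply: (cvg_trans _ cG); apply: (@near_eq_cvg _ _ (nbhs x)).
  by near=> y; rewrite gE//; near: y; exact: open_nbhs_nbhs.
- move=> x clx nOx; have := u0 x clx nOx => ux0.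
  apply/cvgrPdist_lt => eta eta0.
  have := cvgr0_norm_lt _ ux0 _ eta0.
  move=> uxs; near=> y; rewrite sub0r normrN.
  by apply: le_lt_trans (soft_le _ e0) _; near: y; exact: uxs.
Unshelve. all: by end_near. Qed.

Lemma sqr_grad_soft_le Omega u e x : 0 < e -> C10 Omega u -> Omega x ->
  sqr_eucl_norm (grad (soft e \o u) x) <= sqr_eucl_norm (grad u x).
Proof.
move=> e0 [du _ _] Ox; rewrite grad_soft//; last exact: du.
rewrite sqr_eucl_normZ ler_piMl ?sqr_eucl_norm_ge0//.
by have /andP[s0 s1] := soft'_itv (u x) e0; rewrite expr_le1.
Qed.

(** The gradient vanishes where [`|u x| <= e]; the rest of [Omega] lies in a compact
    set on which the gradient of [u] is continuous. *)
Lemma sqr_grad_soft_bounded Omega u e : bounded_set Omega -> 0 < e ->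
  C10 Omega u -> exists2 M, 0 < M &
    forall x, Omega x -> sqr_eucl_norm (grad (soft e \o u) x) <= M.
Proof.
move=> bO e0 Cu; have [du _ _] := Cu.
have cK := C10_compact_superlevel bO Cu e0.
have [|M M0 gM] := continuous_on_compact_bounded cK
    (g := fun x => sqr_eucl_norm (grad u x)).
  by move=> x [Ox _]; exact: continuous_sqr_grad Cu Ox.
exists M => // x Ox; have [ue|ue] := leP e `|u x|.
  by rewrite (le_trans (sqr_grad_soft_le e0 Cu Ox))// (le_trans (ler_norm _) (gM x _)).
rewrite grad_soft//; last exact: du.
by rewrite soft'_eq0 ?(ltW ue)// sqr_eucl_normZ expr0n mul0r ltW.
Qed.

End C10_functions.

(** * Comparison of integrals *)

Section integral_comparison.
Context d0 (T : measurableType d0) (R : realType)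
  (mu : {measure set T -> \bar R}) (D : set T).
Hypothesis mD : measurable D.

(** Comparing positive and negative parts separately leaves room for infinite
    integrals. *)
Lemma measurable_le_integral (g h : T -> \bar R) :
  measurable_fun D g -> measurable_fun D h -> (forall x, D x -> (g x <= h x)%E) ->
  (\int[mu]_(x in D) g x <= \int[mu]_(x in D) h x)%E.
Proof.
move=> mg mh gh; rewrite integralE [leRHS]integralE; apply: leeB.
  apply: ge0_le_integral => //; try exact: measurable_funepos.
  by move=> x Dx; apply: (funepos_le _ (mem_set Dx)) => y /set_mem; exact: gh.
apply: ge0_le_integral => //; try exact: measurable_funeneg.
by move=> x Dx; apply: (funeneg_le _ (mem_set Dx)) => y /set_mem; exact: gh.
Qed.

Hypothesis muD : (mu D < +oo)%E.

Let muE : mu D = (fine (mu D))%:E.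
Proof. by rewrite fineK// ge0_fin_numE. Qed.

Lemma bounded_integrable (k : T -> R) (M : R) : measurable_fun D k ->
  (forall x, D x -> `|k x| <= M) -> mu.-integrable D (EFin \o k).
Proof.
move=> mk kM; apply: measurable_bounded_integrable => //.
exists M; split; first exact: num_real.
by move=> M' MM' x Dx; apply: (le_trans (kM x Dx)); exact: ltW.
Qed.

(** When [F] has infinite integral both sides are [-oo], since the negative part of
    [C - F] is at least [F - C]. *)
Lemma integral_cst_sub (F : T -> \bar R) (C : R) : 0 <= C ->
  measurable_fun D F -> (forall x, D x -> (0 <= F x)%E) ->
  (\int[mu]_(x in D) (C%:E - F x) =
    (C * fine (mu D))%:E - \int[mu]_(x in D) F x)%E.
Proof.
move=> C0 mF F0.
have iC : mu.-integrable D (cst C%:E).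
  by apply: (bounded_integrable (k := cst C) (M := `|C|)).
have intC : (\int[mu]_(x in D) C%:E = (C * fine (mu D))%:E)%E.
  by rewrite integral_cst// {1}muE.
have [Foo|Foo] := ltP (\int[mu]_(x in D) F x)%E +oo%E.
  rewrite integralB// ?intC//; apply/integrableP; split=> //.
  rewrite (eq_integral F)//= => x /[!inE] Dx; by rewrite gee0_abs ?F0.
move: Foo; rewrite leye_eq => /eqP Foo; rewrite Foo/=.
have mg : measurable_fun D (fun x => C%:E - F x)%E by exact: emeasurable_funB.
suff -> : (\int[mu]_(x in D) (C%:E - F x) = -oo)%E by [].
rewrite integralE; set n := (X in (_ - X)%E).
suff -> : n = +oo%E by rewrite addeNy.
have : (\int[mu]_(x in D) F x <= n + (C * fine (mu D))%:E)%E.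
  rewrite -intC -ge0_integralD//; last exact: measurable_funeneg.
  apply: ge0_le_integral => //.
    by apply: emeasurable_funD => //; exact: measurable_funeneg.
  move=> x Dx; rewrite funenegE -leeBlDr// oppeB ?fin_num_adde_defr// addeC.
  by rewrite le_max lexx.
by rewrite Foo leye_eq; case: n => [r| |].
Qed.

Lemma bounded_integral_perturb (g h : T -> R) (M e : R) :
  measurable_fun D g -> measurable_fun D h ->
  (forall x, D x -> `|g x| <= M) -> (forall x, D x -> `|h x| <= M) ->
  (forall x, D x -> g x <= h x + e) ->
  [/\ (\int[mu]_(x in D) (g x)%:E)%E \is a fin_num,
      (\int[mu]_(x in D) (h x)%:E)%E \is a fin_num &
      (\int[mu]_(x in D) (g x)%:E <=
       \int[mu]_(x in D) (h x)%:E + (e * fine (mu D))%:E)%E].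
Proof.
move=> mg mh gM hM gh.
have ig := bounded_integrable mg gM; have ih := bounded_integrable mh hM.
have ie : mu.-integrable D (cst e%:E).
  by apply: (bounded_integrable (k := cst e) (M := `|e|)).
split; try exact: integrable_fin_num.
rewrite (_ : (e * _)%:E = \int[mu]_(x in D) (cst e%:E x))%E; last first.
  by rewrite integral_cst// [in RHS]muE.
rewrite -integralD//; apply: le_integral => //; first exact: integrableD.
by move=> x /[!inE] Dx; rewrite lee_fin gh.
Qed.

End integral_comparison.

(** The constant [V] is the total variation of [nu] on [D]. *)
Lemma charge_integral_perturb d0 (T : measurableType d0) (R : realType)
    (nu : {charge set T -> \bar R}) (D : set T) : measurable D ->
  exists2 V, 0 <= V & forall (g h : T -> R) (M e : R),
    measurable_fun D g -> measurable_fun D h ->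
    (forall x, D x -> `|g x| <= M) -> (forall x, D x -> `|h x| <= M) ->
    (forall x, D x -> `|g x - h x| <= e) ->
    [/\ charge_integral nu D g \is a fin_num,
        charge_integral nu D h \is a fin_num &
        (charge_integral nu D g <= charge_integral nu D h + (e * V)%:E)%E].
Proof.
move=> mD; rewrite /charge_integral.
set m1 := jordan_pos _; set m2 := jordan_neg _.
have m1D : (m1 D < +oo)%E by rewrite -ge0_fin_numE// fin_num_measure.
have m2D : (m2 D < +oo)%E by rewrite -ge0_fin_numE// fin_num_measure.
exists (fine (m1 D) + fine (m2 D)); first by rewrite addr_ge0// fine_ge0.
move=> g h M e mg mh gM hM gh.
have [|g1 h1 gh1] := bounded_integral_perturb mD m1D mg mh gM hM (e := e).
  by move=> x Dx; have := gh x Dx; rewrite ler_norml => /andP[]; lra.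
have [|h2 g2 gh2] := bounded_integral_perturb mD m2D mh mg hM gM (e := e).
  by move=> x Dx; have := gh x Dx; rewrite ler_norml => /andP[]; lra.
split; try by rewrite fin_numB ?g1 ?h1 ?g2 ?h2.
move: gh1 gh2.
rewrite -(fineK g1) -(fineK g2) -(fineK h1) -(fineK h2).
by rewrite -!EFinB -!EFinD !lee_fin; lra.
Qed.

(** * The cost function *)

Section cost.
Context {R : realType} (psi : R -> \bar R).
Hypothesis psi_ge0 : forall s, 0 <= s -> (0 <= psi s)%E.

Lemma ext_psi_ge0 s : (0 <= ext_psi psi s)%E.
Proof. by rewrite /ext_psi; case: ifPn => // s0; exact: psi_ge0. Qed.

Lemma ext_psi_midpoint : convex_nneg psi -> forall s t, 0 <= s -> 0 <= t ->
  (ext_psi psi ((s + t) / 2)%R <=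
   2^-1%:E * ext_psi psi s + 2^-1%:E * ext_psi psi t)%E.
Proof.
move=> cpsi s t s0 t0; rewrite /ext_psi divr_ge0 ?addr_ge0// s0 t0.
have h2 : 0 <= (2^-1 : R) <= 1 by rewrite invr_ge0 ler0n invf_le1 ?ler1n.
have := cpsi s t 2^-1 s0 t0 h2.
have -> : 1 - 2^-1 = 2^-1 :> R by lra.
by rewrite -mulrDr mulrC.
Qed.

(** Past some [s1] the slope [psi s / s] exceeds [M]; before it,
    [M * s <= M * s1] and [psi] is nonnegative, so [C := M * s1] works. *)
Lemma superlinear_affine_minorant : superlinear psi -> forall M, 0 <= M ->
  exists2 C, 0 <= C & forall s, 0 <= s -> ((M * s)%:E <= ext_psi psi s + C%:E)%E.
Proof.
move=> /cvgeyPge sl M M0.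
have [s0 [s0real Ms0]] := sl M.
pose s1 := Num.max s0 0.
have s1_ge0 : 0 <= s1 by rewrite le_max lexx orbT.
exists (M * s1); first exact: mulr_ge0.
move=> s s_ge0; rewrite /ext_psi s_ge0.
have [ss1|ss1] := leP s s1.
  apply: (@le_trans _ _ (M * s1)%:E); first by rewrite lee_fin ler_wpM2l.
  by rewrite leeDr// psi_ge0.
have spos : 0 < s by exact: le_lt_trans ss1.
have : (M%:E <= psi s * s^-1%:E)%E.
  by apply: Ms0; apply: le_lt_trans ss1; rewrite le_max lexx.
rewrite lee_pdivlMr// -EFinM => Mpsi; apply: (le_trans Mpsi).
by rewrite leeDl// lee_fin mulr_ge0.
Qed.

End cost.

(** * Existence of a maximizer *)

Section existence.
Context {R : realType} {d : nat} (Omega : set 'rV[R]_d)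
  (f : {charge set 'rV[R]_d -> \bar R}) (psi : R -> \bar R).
Hypotheses (oO : open Omega) (bO : bounded_set Omega).
Hypothesis psi_ge0 : forall s, 0 <= s -> (0 <= psi s)%E.
Hypothesis psi_convex : convex_nneg psi.
Hypothesis psi_lsc : lower_semicontinuous (ext_psi psi).
Hypothesis psi_superlinear : superlinear psi.
Implicit Types (a u v : 'rV[R]_d -> R) (p : ('rV[R]_d -> R) * R).

Let mu := lebesgue_rV d : {measure set 'rV[R]_d -> \bar R}.
Let mO : measurable Omega := open_measurable_rV oO.

Let muO : (mu Omega < +oo)%E.
Proof. exact: lebesgue_bounded_fin. Qed.

Definition gain a u (x : 'rV[R]_d) : \bar R :=
  ((2^-1 * a x * sqr_eucl_norm (grad u x))%:E - 2^-1%:E * ext_psi psi (a x))%E.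

(** The integrand of [C - gain] as a function of the value [s] of the
    coefficient; the pair [p] is [(u, C)]. *)
Definition deficit p (x : 'rV[R]_d) (s : R) : \bar R :=
  (2^-1%:E * ext_psi psi s +
   (p.2 - 2^-1 * s * sqr_eucl_norm (grad p.1 x))%:E)%E.

Definition admissible p := [/\ C10 Omega p.1, 0 <= p.2 &
  forall x s, Omega x -> 0 <= s -> (0 <= deficit p x s)%E].

Let energy_gain a u : energy Omega psi f a u =
  (\int[mu]_(x in Omega) gain a u x - charge_integral f Omega u)%E.
Proof. by []. Qed.

Lemma gainE a p x : gain a p.1 x = (p.2%:E - deficit p x (a x))%E.
Proof.
rewrite /gain /deficit; have := ext_psi_ge0 psi_ge0 (a x).
case: (ext_psi psi (a x)) => [r _| _|//].
  by rewrite -!EFinM -EFinD -!EFinB; congr EFin; lra.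
by rewrite gt0_muley// lte_fin invr_gt0.
Qed.

Let measurable_psi a : measurable_fun Omega a ->
  measurable_fun Omega (fun x => 2^-1%:E * ext_psi psi (a x))%E.
Proof.
move=> ma; apply: measurable_funeM; apply: measurableT_comp ma.
exact: lower_semicontinuous_measurable.
Qed.

Let measurable_dirichlet a u : measurable_fun Omega a -> C10 Omega u ->
  measurable_fun Omega (fun x => 2^-1 * a x * sqr_eucl_norm (grad u x)).
Proof.
move=> ma Cu; apply: measurable_funM; last exact: measurable_sqr_grad.
by apply: measurable_funM.
Qed.

Lemma measurable_gain a u : measurable_fun Omega a -> C10 Omega u ->
  measurable_fun Omega (gain a u).
Proof.
move=> ma Cu; apply: emeasurable_funB; last exact: measurable_psi.
by apply/measurable_EFinP; exact: measurable_dirichlet.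
Qed.

Lemma measurable_deficit p a : C10 Omega p.1 -> measurable_fun Omega a ->
  measurable_fun Omega (fun x => deficit p x (a x)).
Proof.
move=> Cu ma; apply: emeasurable_funD; first exact: measurable_psi.
by apply/measurable_EFinP; apply: measurable_funB => //; exact: measurable_dirichlet.
Qed.

Lemma deficit_midpoint p x s t : 0 <= s -> 0 <= t ->
  (deficit p x ((s + t) / 2)%R <=
   2^-1%:E * deficit p x s + 2^-1%:E * deficit p x t)%E.
Proof.
move=> s0 t0; rewrite /deficit.
have half0 r : (0 <= 2^-1%:E * ext_psi psi r)%E.
  by apply: mule_ge0; [rewrite lee_fin invr_ge0|exact: ext_psi_ge0].
rewrite !muleDr ?fin_num_adde_defl// addeACA; apply: leeD.
  rewrite -ge0_muleDr//.
  by apply: lee_wpmul2l; [rewrite lee_fin|exact: ext_psi_midpoint].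
by rewrite -!EFinM -EFinD lee_fin; lra.
Qed.

Lemma deficit_lsc p x : lower_semicontinuous (deficit p x).
Proof.
apply: lower_semicontinuousMD; rewrite ?invr_gt0//; first exact: ext_psi_ge0.
move=> s; apply: cvgB; first exact: cvg_cst.
by apply: cvgM; [apply: cvgM; [exact: cvg_cst|exact: cvg_id]|exact: cvg_cst].
Qed.

Lemma charge_integral_C10 : exists2 V, 0 <= V & forall u v (e : R),
    C10 Omega u -> C10 Omega v -> (forall x, Omega x -> `|u x - v x| <= e) ->
  [/\ charge_integral f Omega u \is a fin_num,
      charge_integral f Omega v \is a fin_num &
      (charge_integral f Omega u <= charge_integral f Omega v + (e * V)%:E)%E].
Proof.
have [V V0 pertV] := charge_integral_perturb f mO.
exists V => // u v e Cu Cv uv.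
have [M M0 uM] := C10_bounded bO Cu.
have [N N0 vN] := C10_bounded bO Cv.
apply: (pertV u v (M + N)) => //.
- exact: measurable_C10.
- exact: measurable_C10.
- by move=> x Ox; rewrite (le_trans (uM x Ox))// lerDl ltW.
- by move=> x Ox; rewrite (le_trans (vN x Ox))// lerDr ltW.
Qed.

Lemma charge_integral_fin u : C10 Omega u -> charge_integral f Omega u \is a fin_num.
Proof.
move=> Cu; have [V _ pertV] := charge_integral_C10.
by have [|//] := pertV u u 0 Cu Cu; move=> x _; rewrite subrr normr0.
Qed.

Lemma energy_deficit p a : admissible p -> measurable_fun Omega a ->
  (forall x, 0 <= a x) ->
  energy Omega psi f a p.1 = ((p.2 * fine (mu Omega))%:E -
    \int[mu]_(x in Omega) deficit p x (a x) - charge_integral f Omega p.1)%E.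
Proof.
move=> [Cu C0 D0] ma a0; rewrite energy_gain; congr (_ - _)%E.
rewrite -integral_cst_sub//.
- by apply: eq_integral => x _; exact: gainE.
- exact: measurable_deficit.
- by move=> x Ox; exact: D0.
Qed.

(** A lower bound on the energy is an upper bound on the integral of a
    nonnegative, convex and lower semicontinuous integrand: this is the form
    in which constraints on the coefficient pass to the limit. *)
Lemma energy_ge_deficit_le p a (r : R) : admissible p ->
    measurable_fun Omega a -> (forall x, 0 <= a x) ->
  (r%:E <= energy Omega psi f a p.1)%E <->
  (\int[mu]_(x in Omega) deficit p x (a x) <=
    (p.2 * fine (mu Omega) - fine (charge_integral f Omega p.1) - r)%:E)%E.
Proof.
move=> admp ma a0; rewrite energy_deficit//; have [Cu _ D0] := admp.
have : (0 <= \int[mu]_(x in Omega) deficit p x (a x))%E.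
  by apply: integral_ge0 => x Ox; exact: D0.
rewrite -{1}(fineK (charge_integral_fin Cu)).
case: (\int[mu]_(x in Omega) _)%E => [i _|_|//].
  by rewrite -!EFinB !lee_fin; split; lra.
by rewrite addeNy addNye; split.
Qed.

Lemma bounded_grad_admissible u M : C10 Omega u -> 0 <= M ->
  (forall x, Omega x -> sqr_eucl_norm (grad u x) <= M) ->
  exists C, admissible (u, C).
Proof.
move=> Cu M0 uM.
have [C C0 MC] := superlinear_affine_minorant psi_ge0 psi_superlinear M0.
exists (2^-1 * C); split => //=; first by rewrite mulr_ge0.
move=> x s Ox s0; rewrite /deficit/=.
apply: (@le_trans _ _ (2^-1%:E * (ext_psi psi s + C%:E - (M * s)%:E))%E).
  by rewrite mule_ge0// sube_ge0 ?MC.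
rewrite -addeA -EFinB muleDr// ?fin_num_adde_defl// leeD2l//.
rewrite -EFinM lee_fin mulrBr lerB// -mulrA ler_wpM2l// mulrC ler_wpM2r//.
exact: uM.
Qed.

Lemma C10_cst0 : C10 Omega (cst 0).
Proof.
have g0 x : grad (cst 0 : 'rV[R]_d -> R) x = 0.
  by apply/rowP => i; rewrite !mxE derive_cst.
split.
- by move=> x _; exact: differentiable_cst.
- move=> x _; rewrite (_ : grad _ = cst 0); last exact/funext.
  exact: cst_continuous.
- by move=> x _ _; exact: cvg_cst.
Qed.

(** Testing with [u = 0] bounds the integral of the cost alone, which by
    superlinearity controls the integral of the coefficient. *)
Lemma coercive_admissible : exists2 C, admissible (cst 0, C) &
  forall x s, Omega x -> 0 <= s -> (s%:E <= deficit (cst 0%R, C) x s)%E.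
Proof.
have g0 x : sqr_eucl_norm (grad (cst 0 : 'rV[R]_d -> R) x) = 0.
  rewrite /sqr_eucl_norm big1// => i _.
  by rewrite !mxE derive_cst expr0n.
have [C C0 MC] := superlinear_affine_minorant psi_ge0 psi_superlinear (ler0n R 2).
have co x s : Omega x -> 0 <= s -> (s%:E <= deficit (cst 0%R, 2^-1 * C)%R x s)%E.
  move=> Ox s0; rewrite /deficit/= g0 mulr0 subr0.
  apply: (@le_trans _ _ (2^-1%:E * (ext_psi psi s + C%:E))%E).
    rewrite (_ : s%:E = 2^-1%:E * (2 * s)%:E)%E; last first.
      by rewrite -EFinM mulKf.
    by apply: lee_wpmul2l; [rewrite lee_fin|exact: MC].
  by rewrite muleDr// fin_num_adde_defl.
exists (2^-1 * C) => //; split => /=; [exact: C10_cst0|by rewrite mulr_ge0|].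
by move=> x s Ox s0; apply: le_trans (co x s Ox s0); rewrite lee_fin.
Qed.

Lemma energy_max0 a u : L1_nneg Omega a -> C10 Omega u ->
  energy Omega psi f (fun x => Num.max (a x) 0) u = energy Omega psi f a u.
Proof.
move=> [/measurable_int/measurable_EFinP ma a0] Cu.
rewrite !energy_gain; congr (_ - _)%E.
apply: ae_eq_integral => //.
- by apply: measurable_gain => //; exact: measurable_maxr.
- exact: measurable_gain.
- by apply: filterS a0 => x ax Ox; rewrite /gain (max_l (ax Ox)).
Qed.

(** Replacing [u] by its soft threshold decreases the gain pointwise and moves
    the load term by [O(e)]; and the soft threshold is admissible with some
    constant, its gradient being bounded. Letting [e] tend to [0], lower bounds
    for admissible functions extend to all of [C10 Omega]. *)
Lemma energy_ge_C10 a (r : R) : measurable_fun Omega a -> (forall x, 0 <= a x) ->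
  (forall p, admissible p -> (r%:E <= energy Omega psi f a p.1)%E) ->
  forall u, C10 Omega u -> (r%:E <= energy Omega psi f a u)%E.
Proof.
move=> ma a0 ra u Cu; have [V V0 pertV] := charge_integral_C10.
apply/lee_subgt0Pr => eta eta0.
pose e := eta / (2 * (V + 1)).
have V1 : 0 < 2 * (V + 1) by rewrite mulr_gt0// ltr_wpDl.
have e0 : 0 < e by rewrite divr_gt0.
have Cv := C10_soft oO e0 Cu.
have [M M0 vM] := sqr_grad_soft_bounded bO e0 Cu.
have [C admv] := bounded_grad_admissible Cv (ltW M0) vM.
have [cu cv cuv] : [/\ charge_integral f Omega u \is a fin_num,
    charge_integral f Omega (soft e \o u) \is a fin_num &
    (charge_integral f Omega u <=
     charge_integral f Omega (soft e \o u) + (2 * e * V)%:E)%E].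
  by apply: pertV => // x _; rewrite distrC; exact: soft_dist.
have eV : 2 * e * V <= eta.
  have : e * (2 * (V + 1)) = eta by rewrite divfK// gt_eqF.
  by lra.
have gains : (\int[mu]_(x in Omega) gain a (soft e \o u) x <=
              \int[mu]_(x in Omega) gain a u x)%E.
  apply: measurable_le_integral => //; try exact: measurable_gain.
  move=> x Ox; rewrite /gain leeB// lee_fin ler_wpM2l ?mulr_ge0//.
  exact: (sqr_grad_soft_le e0 Cu Ox).
apply: (@le_trans _ _ (energy Omega psi f a (soft e \o u) - eta%:E)%E).
  by apply: leeB => //; exact: ra admv.
rewrite !energy_gain -addeA -oppeD ?fin_num_adde_defl//; apply: leeB => //.
by apply: (le_trans cuv); rewrite leeD2l// lee_fin.
Qed.

Lemma calE_sup_fin : (exists2 a, L1_nneg Omega a & (-oo < calE Omega psi f a)%E) ->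
  ereal_sup [set calE Omega psi f a | a in L1_nneg Omega] \is a fin_num.
Proof.
move=> [b Lb bNy]; have [C adm0 _] := coercive_admissible.
rewrite fin_numElt; apply/andP; split.
  by apply: (lt_le_trans bNy); apply: ereal_sup_ubound; exists b.
apply: (@le_lt_trans _ _
  ((C * fine (mu Omega))%:E - charge_integral f Omega (cst 0%R))%E); last first.
  have := charge_integral_fin C10_cst0; case: charge_integral => // r _.
  by rewrite -EFinB ltry.
apply: ge_ereal_sup => _ [a La <-].
apply: (@le_trans _ _ (energy Omega psi f a (cst 0%R))).
  by apply: ereal_inf_lbound; exists (cst 0) => //; exact: C10_cst0.
rewrite -energy_max0//; last exact: C10_cst0.
rewrite (energy_deficit adm0); last 2 first.
- by have [/measurable_int/measurable_EFinP ma _] := La; exact: measurable_maxr.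
- by move=> x; rewrite le_max lexx orbT.
rewrite leeB// geeDl// oppe_le0; apply: integral_ge0 => x Ox.
by have [_ _] := adm0; apply => //; rewrite le_max lexx orbT.
Qed.

Lemma calE_maximizer :
    (exists2 a, L1_nneg Omega a & (-oo < calE Omega psi f a)%E) ->
  exists2 aopt, L1_nneg Omega aopt &
    forall a, L1_nneg Omega a -> (calE Omega psi f a <= calE Omega psi f aopt)%E.
Proof.
move=> /calE_sup_fin; set S := ereal_sup _ => Sfin.
have [C0 adm0 co] := coercive_admissible.
pose kappa (i : {p | admissible p}) := (sval i).2 * fine (mu Omega)
  - fine (charge_integral f Omega (sval i).1) - fine S.
have [aopt [maopt aopt0 aoptP]] : exists a : 'rV[R]_d -> R,
    [/\ measurable_fun Omega a, forall x, 0 <= a x & forall i,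
     (\int[mu]_(x in Omega) deficit (sval i) x (a x) <= (kappa i)%:E)%E].
  apply: (@convex_lsc_selection _ _ _ mu Omega mO muO _
      (fun i => deficit (sval i)) kappa (exist _ _ adm0)).
  - by move=> [p [_ _ D0]] /= x s Ox s0; exact: D0.
  - by move=> [p [Cp _ _]] /= a ma a0; exact: measurable_deficit.
  - by move=> i x s t Ox; exact: deficit_midpoint.
  - by move=> i x Ox; exact: deficit_lsc.
  - by move=> x s Ox s0; exact: co.
  - move=> e e0.
    have [_ [a La <-] aS] := ub_ereal_sup_adherent e0 Sfin.
    have ma : measurable_fun Omega (fun x => Num.max (a x) 0).
      by have [/measurable_int/measurable_EFinP ma _] := La; exact: measurable_maxr.
    have a0 x : 0 <= Num.max (a x) 0 by rewrite le_max lexx orbT.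
    exists (fun x => Num.max (a x) 0); split => // -[p admp]; rewrite /kappa/=.
    have [Cp _ _] := admp.
    have /(energy_ge_deficit_le _ admp ma a0) :
        ((fine S - e)%:E <= energy Omega psi f (fun x => Num.max (a x) 0%R) p.1)%E.
      rewrite energy_max0// EFinB fineK//; apply: (le_trans (ltW aS)).
      by apply: ereal_inf_lbound; exists p.1.
    by move=> le; apply: (le_trans le); rewrite lee_fin; lra.
have aopt_ge u : C10 Omega u -> (S <= energy Omega psi f aopt u)%E.
  rewrite -(fineK Sfin); apply: energy_ge_C10 => // p admp.
  by apply/energy_ge_deficit_le => //; exact: (aoptP (exist _ _ admp)).
exists aopt.
  split; last by apply: aeW => x _.
  apply/integrableP; split; first exact/measurable_EFinP.
  apply: (le_lt_trans _ (ltry (kappa (exist _ _ adm0)))).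
  apply: (le_trans _ (aoptP (exist _ _ adm0))).
  apply: ge0_le_integral => //.
  - by apply: measurableT_comp => //; exact/measurable_EFinP.
  - by apply: measurable_deficit => //; have [] := adm0.
  - by move=> x Ox; rewrite /= ger0_norm//; exact: co.
move=> a La; apply: (@le_trans _ _ S).
  by apply: ereal_sup_ubound; exists a.
by apply: le_ereal_inf_tmp => _ [u Cu <-]; exact: aopt_ge.
Qed.

End existence.

Theorem theorem2p1 (R : realType) (d : nat) (Omega : set 'rV[R]_d)
    (f : {charge set 'rV[R]_d -> \bar R}) (psi : R -> \bar R) :
  open Omega -> bounded_set Omega ->
  (forall s, 0 <= s -> (0 <= psi s)%E) ->
  convex_nneg psi ->
  lower_semicontinuous (ext_psi psi) ->
  superlinear psi ->
  (exists2 a, L1_nneg Omega a & (-oo < calE Omega psi f a)%E) ->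
  exists2 aopt, L1_nneg Omega aopt &
    forall a, L1_nneg Omega a -> (calE Omega psi f a <= calE Omega psi f aopt)%E.
Proof. by move=> *; exact: calE_maximizer. Qed.
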